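(* Let $M$ be a mean such that all the associated functions $\varphi_x$ ($x>0$), given by $\varphi_x:(-2x,2x)\to(0,+\infty)$, $\varphi_x(t):=M\left(x+\frac t2,\,x-\frac t2\right)$, admit a Taylor series expansion around $0$ (i.e. each $\varphi_x$ coincides with the sum of its Taylor series at $0$ on some neighborhood of $0$). Then there exists a sequence of real-valued functions $(f_n)_{n\ge 1}$, defined on $(0,+\infty)$, such that for $(x,y)$ in a neighborhood of the first bisector: $$M(x,y)=A+f_1(A)\,(x-y)^2+f_2(A)\,(x-y)^4+\cdots=A+\sum_{n=1}^{+\infty} f_n(A)\,(x-y)^{2n},$$ where $A=A(x,y)=\frac{x+y}{2}$.
   Context: A mean is a function $M:(0,+\infty)^2\to(0,+\infty)$ of class $C^\infty$ such that $\min(x,y)\le M(x,y)\le\max(x,y)$ and $M(x,y)=M(y,x)$ for all $x,y>0$. The first bisector is the diagonal $\{(x,x):x>0\}$ of $(0,+\infty)^2$.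
   Formalization: ''Neighborhood of the first bisector'' is taken along perpendiculars: for each x>0 it contains (x+t/2, x-t/2) for all small |t|, how small depending on x; with a topological neighborhood the claim is false, as the radii of the Taylor expansions need not be locally bounded below. *)

(* Defs.v *)
From Stdlib Require Import Reals Factorial.
From Coquelicot Require Import Coquelicot.
Open Scope R_scope.

(* Functions on (0,+oo)^2 are represented by total functions R -> R -> R whose
   values off the open quadrant are never constrained.  Since the quadrant is
   open, Coquelicot's [ex_diff_n M n] (continuity of M together with existence
   and continuity of all partial derivatives up to order n) at each of its
   points for every n is C^oo regularity there.  Positivity of M on the
   quadrant follows from [mean_ge_min]. *)
Record is_mean (M : R -> R -> R) : Prop := {
  mean_smooth : forall (n : nat) (x y : R),
    0 < x -> 0 < y -> ex_diff_n M n x y;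
  mean_ge_min : forall x y : R, 0 < x -> 0 < y -> Rmin x y <= M x y;
  mean_le_max : forall x y : R, 0 < x -> 0 < y -> M x y <= Rmax x y;
  mean_sym : forall x y : R, 0 < x -> 0 < y -> M x y = M y x
}.

(* Meaningful for -2x < t < 2x; only the germ at t = 0 is used below. *)
Definition phi (M : R -> R -> R) (x t : R) : R := M (x + t / 2) (x - t / 2).

Definition taylor_coef (g : R -> R) (n : nat) : R :=
  Derive_n g n 0 / INR (fact n).

Definition taylor_expandable_at_0 (g : R -> R) : Prop :=
  locally 0 (fun t : R => is_pseries (taylor_coef g) t (g t)).

(* A subset U of the quadrant is a neighborhood of the first bisector when each
   line perpendicular to the bisector, t |-> (x + t/2, x - t/2), stays in U for
   |t| small, how small depending on x.

   U is not required to be a neighborhood of the diagonal for the product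
   topology: the theorem would then fail, because the size of the interval on
   which phi_x equals its Taylor series need not be locally bounded below in x.
   For instance, with s := (x + y)/2 - 1 and c > 0 small,
     M x y := (x + y)/2 + c * exp(-1/s^2) * (x - y)^2 / ((x - y)^2 + s^2)
   (and M x y := (x + y)/2 if s = 0) is a C^oo mean all of whose phi_x are
   Taylor expandable at 0, but on the line s = const <> 0 the series, whose
   coefficients are uniquely determined, diverges as soon as |x - y| >= |s|. *)
Definition bisector_neighborhood (U : R -> R -> Prop) : Prop :=
  (forall x y : R, U x y -> 0 < x /\ 0 < y) /\
  (forall x : R, 0 < x -> locally 0 (fun t : R => U (x + t / 2) (x - t / 2))).

(* Main.v *)
Require Import Defs.
From Stdlib Require Import Reals Lra Lia.
From Coquelicot Require Import Coquelicot.
Open Scope R_scope.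

(** Fix the midpoint [A]: on the perpendicular to the bisector through [(A, A)],
    with [t = x - y], the mean is [M x y = phi M A t].  Symmetry of [M] makes
    [phi M A] even, so averaging its Taylor series at [t] and at [- t] still
    sums to [phi M A t]; the odd terms cancel and the even ones remain unchanged
    ([is_series_even_part]).  The constant term is [M A A = A], since [A] is
    squeezed between the minimum and the maximum of [A] and [A].  Hence [f n A]
    is the Taylor coefficient of order [2 n] of [phi M A].

    The neighborhood consists of the points [(x, y)] of the quadrant for which
    the Taylor series of [phi M A] converges to it both at [x - y] and at
    [y - x].  On each perpendicular to the bisector this holds near the foot,
    by the expandability of that one [phi M A]; no uniformity in [A] is claimed. *)

(** The partial sums of the even terms form a subsequence of all partial
    sums. *)
Lemma is_series_even_terms (u : nat -> R) (l : R) :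
  (forall n, u (S (2 * n)) = 0) ->
  is_series u l -> is_series (fun n => u (2 * n)%nat) l.
Proof.
  intros Hodd Hu.
  assert (Hsum : forall N,
             sum_n u (2 * N) = sum_n (fun n => u (2 * n)%nat) N).
  { induction N as [|N IH].
    - now rewrite !sum_O.
    - replace (2 * S N)%nat with (S (S (2 * N))) by lia.
      rewrite !sum_Sn, IH, Hodd.
      replace (2 * S N)%nat with (S (S (2 * N))) by lia.
      unfold plus; simpl; ring. }
  apply (is_lim_seq_ext _ _ (Finite l) Hsum).
  apply (is_lim_seq_subseq (sum_n u) (Finite l) (fun N => (2 * N)%nat)).
  - apply eventually_subseq; intros n; lia.
  - exact Hu.
Qed.

(** In half the sum of the series at [t] and at [- t], the odd powers cancel,
    while each even power keeps its coefficient. *)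
Lemma is_series_even_part (a : nat -> R) (t l : R) :
  is_pseries a t l -> is_pseries a (- t) l ->
  is_series (fun n => a (2 * n)%nat * t ^ (2 * n)) l.
Proof.
  intros H1 H2; apply is_pseries_R in H1; apply is_pseries_R in H2.
  assert (Hterm : forall n,
             / 2 * (a (2 * n)%nat * t ^ (2 * n) + a (2 * n)%nat * (- t) ^ (2 * n))
             = a (2 * n)%nat * t ^ (2 * n)).
  { intros n; rewrite !pow_mult; replace ((- t) ^ 2) with (t ^ 2) by ring.
    field. }
  apply (is_series_ext _ _ _ Hterm).
  apply (is_series_even_terms
           (fun n => / 2 * (a n * t ^ n + a n * (- t) ^ n))).
  - intros n; rewrite <- !tech_pow_Rmult, !pow_mult.
    replace ((- t) ^ 2) with (t ^ 2) by ring; ring.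
  - replace l with (/ 2 * (l + l)) by field.
    exact (is_series_scal_l (/ 2 : R_AbsRing) _ _ (is_series_plus _ _ _ _ H1 H2)).
Qed.

Lemma locally_0_opp (P : R -> Prop) :
  locally 0 P -> locally 0 (fun t => P (- t)).
Proof.
  intros HP.
  apply (filterlim_opp (0 : R)).
  change (locally (- 0) P); rewrite Ropp_0; exact HP.
Qed.

Lemma mean_diag (M : R -> R -> R) (x : R) :
  is_mean M -> 0 < x -> M x x = x.
Proof.
  intros hM Hx.
  pose proof (mean_ge_min M hM x x Hx Hx) as Hmin.
  pose proof (mean_le_max M hM x x Hx Hx) as Hmax.
  rewrite Rmin_left in Hmin by lra.
  rewrite Rmax_left in Hmax by lra.
  lra.
Qed.

Lemma phi_midpoint (M : R -> R -> R) (x y : R) :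
  phi M ((x + y) / 2) (x - y) = M x y.
Proof. unfold phi; f_equal; field. Qed.

Lemma phi_midpoint_opp (M : R -> R -> R) (x y : R) :
  phi M ((x + y) / 2) (- (x - y)) = M y x.
Proof. unfold phi; f_equal; field. Qed.

Lemma taylor_coef_phi_0 (M : R -> R -> R) (x : R) :
  is_mean M -> 0 < x -> taylor_coef (phi M x) 0 = x.
Proof.
  intros hM Hx; unfold taylor_coef, phi; simpl.
  replace (x + 0 / 2) with x by field; replace (x - 0 / 2) with x by field.
  rewrite (mean_diag M x hM Hx); field.
Qed.

Theorem theorem2p1 (M : R -> R -> R) (hM : is_mean M)
  (hT : forall x : R, 0 < x -> taylor_expandable_at_0 (phi M x)) :
  exists (f : nat -> R -> R) (U : R -> R -> Prop),
    bisector_neighborhood U /\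
    forall x y : R, U x y ->
      let A := (x + y) / 2 in
      ex_series (fun n : nat => f (S n) A * (x - y) ^ (2 * S n)) /\
      M x y = A + Series (fun n : nat => f (S n) A * (x - y) ^ (2 * S n)).
Proof.
  set (expands := fun A t =>
         is_pseries (taylor_coef (phi M A)) t (phi M A t)).
  exists (fun n A => taylor_coef (phi M A) (2 * n)).
  exists (fun x y => (0 < x /\ 0 < y) /\
            expands ((x + y) / 2) (x - y) /\ expands ((x + y) / 2) (- (x - y))).
  split; [split|].
  - now intros x y [Hxy _].
  - intros x Hx.
    assert (Hpos : locally 0 (fun t => 0 < x + t / 2 /\ 0 < x - t / 2)).
    { exists (mkposreal x Hx); intros t Ht.
      apply Rabs_lt_between in Ht; unfold minus, plus, opp in Ht; simpl in Ht.
      lra. }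
    pose proof (locally_0_opp _ (hT x Hx)) as Hopp.
    assert (Hmid : forall t, (x + t / 2 + (x - t / 2)) / 2 = x)
      by (intros t; field).
    assert (Hdiff : forall t, x + t / 2 - (x - t / 2) = t)
      by (intros t; field).
    generalize (filter_and _ _ Hpos (filter_and _ _ (hT x Hx) Hopp)).
    apply filter_imp; intros t [Ht Hexp].
    rewrite Hmid, Hdiff.
    now split.
  - intros x y [[Hx Hy] [H1 H2]] A.
    unfold expands in H1, H2.
    rewrite phi_midpoint in H1.
    rewrite phi_midpoint_opp, <- (mean_sym M hM x y Hx Hy) in H2.
    pose proof (is_series_even_part _ _ _ H1 H2) as Heven.
    assert (HA : 0 < (x + y) / 2) by lra.
    assert (Htail : is_series (fun n =>
              taylor_coef (phi M A) (2 * S n) * (x - y) ^ (2 * S n))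
              (M x y - A)).
    { apply (is_series_incr_1 (fun n =>
               taylor_coef (phi M A) (2 * n) * (x - y) ^ (2 * n))).
      match goal with |- is_series _ ?l => replace l with (M x y) end.
      + exact Heven.
      + rewrite Nat.mul_0_r, pow_O; unfold A at 2.
        rewrite (taylor_coef_phi_0 M _ hM HA); fold A.
        unfold plus; simpl; ring. }
    split.
    + now exists (M x y - A).
    + rewrite (is_series_unique _ _ Htail); ring.
Qed.
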